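(* For every time instant $\tau\in\{1,\dots,N\}$ and every Borel set $\mathcal{G}\subseteq\mathbb{R}^n$, the law of the state $\boldsymbol{x}_\tau$ of the DPV system satisfies $$\mathbb{P}\{\boldsymbol{x}_\tau\in\mathcal{G}\}=\mathbb{P}\left\{\boldsymbol{W}_\tau\in\mathcal{G}\oplus\{-\overline{x}_{\mathrm{nodist}}(\tau)\}\right\}.$$
   Context: DPV system (discrete-time affine parameter-varying stochastic system). Fix $N,n,m,p,l\ge 1$, a finite set $\mathcal{P}\subset\mathbb{R}^l$ and maps $A:\mathcal{P}\to\mathbb{R}^{n\times n}$, $B:\mathcal{P}\to\mathbb{R}^{n\times m}$, $F:\mathcal{P}\to\mathbb{R}^{n\times p}$. For $t=0,\dots,N-1$, $$\boldsymbol{x}_{t+1}=A(\overline\lambda_t)\boldsymbol{x}_t+B(\overline\lambda_t)\overline{u}_t+F(\overline\lambda_t)\boldsymbol{w}_t,$$ where the initial state $\boldsymbol{x}_0=\overline{x}_0\in\mathbb{R}^n$, the parameters $\overline\lambda_0,\dots,\overline\lambda_{N-1}\in\mathcal{P}$ and the inputs $\overline{u}_0,\dots,\overline{u}_{N-1}\in\mathbb{R}^m$ are known and deterministic, and $\boldsymbol{w}_0,\dots,\boldsymbol{w}_{N-1}$ are IID random vectors in $\mathbb{R}^p$ with a probability density. Notation: for $0\le i<j$ let $\mathscr{A}(i,j)=A(\overline\lambda_{j-1})A(\overline\lambda_{j-2})\cdots A(\overline\lambda_i)$ and $\mathscr{A}(i,i)=I_n$. Let $$\mathscr{C}_U(\tau)=[\mathscr{A}(\tau,\tau)B(\overline\lambda_{\tau-1})\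 \ \mathscr{A}(\tau-1,\tau)B(\overline\lambda_{\tau-2})\ \cdots\ \mathscr{A}(1,\tau)B(\overline\lambda_0)]\in\mathbb{R}^{n\times m\tau},$$ $$\mathscr{C}_W(\tau)=[\mathscr{A}(\tau,\tau)F(\overline\lambda_{\tau-1})\ \ \mathscr{A}(\tau-1,\tau)F(\overline\lambda_{\tau-2})\ \cdots\ \mathscr{A}(1,\tau)F(\overline\lambda_0)]\in\mathbb{R}^{n\times p\tau}.$$ Let $\overline{U}_{\tau-1}=[\overline{u}_{\tau-1}^\top\ \cdots\ \overline{u}_0^\top]^\top$ and $\overline{\boldsymbol{w}}_{\tau-1}=[\boldsymbol{w}_{\tau-1}^\top\ \cdots\ \boldsymbol{w}_0^\top]^\top$. The unperturbed state is $\overline{x}_{\mathrm{nodist}}(\tau)=\mathscr{A}(0,\tau)\overline{x}_0+\mathscr{C}_U(\tau)\overline{U}_{\tau-1}$, and $\boldsymbol{W}_\tau=\mathscr{C}_W(\tau)\overline{\boldsymbol{w}}_{\tau-1}$. The symbol $\oplus$ denotes the Minkowski sum. The law of $\boldsymbol{x}_\tau$ is called the forward stochastic reach probability measure (FSRPM). *)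

(* Defs.v *)
From HB Require Import structures.
From mathcomp Require Import all_boot all_order all_algebra finmap.
From mathcomp Require Import all_classical all_reals all_analysis.
From mathcomp Require Import measurable_realfun.
Set Implicit Arguments.
Unset Strict Implicit.
Unset Printing Implicit Defensive.
Import Order.TTheory GRing.Theory Num.Theory.
Import numFieldNormedType.Exports.
Local Open Scope classical_set_scope.
Local Open Scope ring_scope.

Definition borel_display : measure_display.
Proof. exact: default_measure_display. Qed.

(* Real matrices, hence the column vectors of R^n, carry their Borel
   sigma-algebra, generated by the open sets of the library's topology. *)
Section borel_matrix.
Context {R : realType} {m n : nat}.

Let borel0 : <<s @open 'M[R]_(m, n) >> set0.
Proof. exact: sigma_algebra0. Qed.

Let borelC (A : set 'M[R]_(m, n)) :
  <<s @open 'M[R]_(m, n) >> A -> <<s @open 'M[R]_(m, n) >> (~` A).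
Proof. exact: sigma_algebraC. Qed.

Let borelU (F : (set 'M[R]_(m, n))^nat) :
  (forall i, <<s @open 'M[R]_(m, n) >> (F i)) ->
  <<s @open 'M[R]_(m, n) >> (\bigcup_i F i).
Proof. exact: sigma_algebra_bigcup. Qed.

HB.instance Definition _ :=
  @isMeasurable.Build borel_display 'M[R]_(m, n)
    <<s @open 'M[R]_(m, n) >> borel0 borelC borelU.

End borel_matrix.

Section borel_matrix_theory.
Context {R : realType} {m n : nat}.

Lemma measurable_coord i j :
  measurable_fun [set: 'M[R]_(m, n)] (fun M : 'M[R]_(m, n) => M i j).
Proof.
apply: (measurability _ (@RGenOpens.measurableE R)) => _ [_ [a [b ->]] <-].
rewrite setTI; apply: sub_sigma_algebra.
apply: open_comp; last exact: interval_open.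
by move=> M _; exact: coord_continuous.
Qed.

Lemma open_rat_box (O : set 'M[R]_(m, n)) : open O ->
  O = \bigcup_(q : 'M[rat]_(m, n) * nat)
        [set M | [set M' : 'M[R]_(m, n) |
                   forall i j, `|M' i j - ratr (q.1 i j)| < q.2.+1%:R^-1] `<=` O
                 /\ forall i j, `|M i j - ratr (q.1 i j)| < q.2.+1%:R^-1].
Proof.
move=> oO; apply/seteqP; split=> [M OM|M [q _ [qO /qO]]//].
have /nbhs_ballP[e /= e0 eO] := open_nbhs_nbhs (conj oO OM).
have [k ke] : exists k : nat, k.+1%:R^-1 < e / 2.
  have e20 : 0 < e / 2 by rewrite divr_gt0.
  exists (Num.truncn (e / 2)^-1).
  by rewrite invf_plt ?posrE// ?truncnS_gt.
pose r : R := k.+1%:R^-1.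
have r0 : 0 < r by rewrite invr_gt0.
have apx x : exists q : rat, `|x - ratr q| < r.
  have /rat_in_itvoo[q] : x - r < x + r by rewrite ltrD2l gt0_cp.
  rewrite in_itv/= => /andP[q1 q2]; exists q.
  by rewrite distrC ltr_distl q1.
pose Q := \matrix_(i, j) xchoose (apx (M i j)).
have MQ i j : `|M i j - ratr (Q i j)| < r.
  by rewrite mxE; exact: (xchooseP (apx (M i j))).
exists (Q, k) => //=; split=> // M' M'Q; apply: eO; split=> // i j.
rewrite /ball/=.
rewrite (le_lt_trans (ler_distD (ratr (Q i j)) _ _))//.
rewrite [e]splitr ltrD//; first exact: lt_trans ke.
by rewrite distrC; exact: lt_trans (M'Q i j) ke.
Qed.

Lemma measurable_fun_coordP d (T : measurableType d) (f : T -> 'M[R]_(m, n)) :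
  (forall i j, measurable_fun [set: T] (fun t => f t i j)) ->
  measurable_fun [set: T] f.
Proof.
move=> mf.
apply: (@measurability _ _ _ _ _ _ (@open 'M[R]_(m, n))) => // _ [V oV <-].
rewrite setTI (open_rat_box oV) preimage_bigcup.
apply: countable_bigcupT_measurable => // -[q k].
have [qV|nqV] := pselect ([set M : 'M[R]_(m, n) |
    forall i j, `|M i j - ratr (q i j)| < k.+1%:R^-1] `<=` V); last first.
  rewrite [X in measurable X](_ : _ = set0)//.
  by apply/seteqP; split=> // t [].
rewrite [X in measurable X](_ : _ = \bigcap_(ij in [set: 'I_m * 'I_n])
    ((fun t => f t ij.1 ij.2) @^-1` ball (ratr (q ij.1 ij.2) : R) k.+1%:R^-1)).
  apply: fin_bigcap_measurable => // -[i j] _ /=.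
  by rewrite -[X in measurable X]setTI; apply: mf => //; exact: measurable_ball.
apply/seteqP; split=> t /=.
  by move=> [_ H] [i j] _ /=; rewrite /ball/= distrC; exact: H.
by move=> H; split=> // i j; have := H (i, j) I; rewrite /= /ball/= distrC.
Qed.

End borel_matrix_theory.

Section lebesgue_vector.
Context {R : realType}.

Definition cons_cV p (z : R * 'cV[R]_p) : 'cV[R]_p.+1 := col_mx z.1%:M z.2.

Let cons_cV_head p z (k : 'I_1) j : @cons_cV p z (lshift p k) j = z.1.
Proof. by rewrite [LHS]col_mxEu mxE !ord1 eqxx mulr1n. Qed.

Let cons_cV_tail p z (k : 'I_p) j : @cons_cV p z (rshift 1 k) j = z.2 k j.
Proof. by rewrite [LHS]col_mxEd. Qed.

Lemma measurable_cons_cV p : measurable_fun setT (@cons_cV p).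
Proof.
apply: measurable_fun_coordP => i j.
case: (@split_ordP 1 p i) => k ->.
- apply: (eq_measurable_fun (fun z : R * 'cV[R]_p => z.1)) => [z _|].
    by rewrite cons_cV_head.
  exact: measurable_fst.
- apply: (eq_measurable_fun (fun z : R * 'cV[R]_p => z.2 k j)) => [z _|].
    by rewrite cons_cV_tail.
  by apply: (measurableT_comp (measurable_coord k j)); exact: measurable_snd.
Qed.

HB.instance Definition _ p :=
  isMeasurableFun.Build _ _ _ _ (@cons_cV p) (@measurable_cons_cV p).

Section step.
Context {p : nat} (mu : {sigma_finite_measure set 'cV[R]_p -> \bar R}).

Definition lebesgue_step : set 'cV[R]_p.+1 -> \bar R :=
  pushforward (@lebesgue_measure R \x mu)%E (@cons_cV p).

Let lebesgue_step0 : lebesgue_step set0 = 0%E.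
Proof. by rewrite /lebesgue_step /pushforward preimage_set0 measure0. Qed.

Let lebesgue_step_ge0 A : (0 <= lebesgue_step A)%E.
Proof. by rewrite /lebesgue_step /pushforward; exact: measure_ge0. Qed.

Let lebesgue_step_sigma_additive : semi_sigma_additive lebesgue_step.
Proof.
move=> E mE tE mUE; rewrite /lebesgue_step /pushforward preimage_bigcup.
apply: measure_semi_sigma_additive.
- by move=> k; rewrite -[X in measurable X]setTI; exact: measurable_cons_cV.
- apply/trivIsetP => /= i j _ _ ij; rewrite -preimage_setI.
  by move/trivIsetP : tE => /(_ _ _ _ _ ij) ->//; rewrite preimage_set0.
- rewrite -preimage_bigcup -[X in measurable X]setTI.
  exact: measurable_cons_cV.
Qed.

HB.instance Definition _ := isMeasure.Build _ _ _ lebesgue_step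
  lebesgue_step0 lebesgue_step_ge0 lebesgue_step_sigma_additive.

Let lebesgue_step_sigma_finite : sigma_finite setT lebesgue_step.
Proof.
have [F FT Foo] : sigma_finite setT (@lebesgue_measure R \x mu)%E.
  have /sigma_finiteP[F1 [F1T ndF1 F1oo]] := sigma_finiteT (@lebesgue_measure R).
  have /sigma_finiteP[F2 [F2T ndF2 F2oo]] := sigma_finiteT mu.
  exists (fun k => F1 k `*` F2 k) => [|k].
    rewrite -setXTT F1T F2T predeqE => -[x y]; split; last first.
      by move=> [k _ []/= ? ?]; split; exists k.
    move=> [/= [i _ Fix] [k _ Fky]]; exists (maxn i k) => //; split.
    - by move: x Fix; exact/subsetPset/ndF1/leq_maxl.
    - by move: y Fky; exact/subsetPset/ndF2/leq_maxr.
  have [? ?] := F1oo k; have [? ?] := F2oo k.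
  split; first exact: measurableX.
  by rewrite product_measure1E// lte_mul_pinfty// ge0_fin_numE.
pose h (v : 'cV[R]_(1 + p)) : R * 'cV[R]_p := (v ord0 ord0, dsubmx v).
have hK z : h (cons_cV z) = z.
  case: z => x v; rewrite /h [dsubmx _]col_mxKd; congr (_, _).
  have -> : ord0 = lshift p (ord0 : 'I_1) by exact: val_inj.
  exact: cons_cV_head.
have mh : measurable_fun setT h.
  apply/measurable_fun_pairP; split; first exact: measurable_coord.
  apply: measurable_fun_coordP => i j /=.
  apply: (eq_measurable_fun (fun v : 'cV[R]_(1 + p) => v (rshift 1 i) j)).
    by move=> v _; rewrite /= mxE.
  exact: measurable_coord.
exists (fun k => h @^-1` F k); first by rewrite -preimage_bigcup -FT preimage_setT.
move=> k; have [mF Fk] := Foo k; split.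
  by rewrite -[X in measurable X]setTI; exact: mh.
rewrite /lebesgue_step /pushforward -comp_preimage.
by rewrite [X in X @^-1` _](_ : _ = id)//; apply/funext => z /=; exact: hK.
Qed.

HB.instance Definition _ :=
  Measure_isSigmaFinite.Build _ _ _ lebesgue_step lebesgue_step_sigma_finite.

End step.

(* Lebesgue measure on R^p: the p-fold product of the Lebesgue measure on R,
   transported along R * R^p ~ R^(p+1); R^0 is a single point of mass 1. *)
Fixpoint lebesgue_cV (p : nat) : {sigma_finite_measure set 'cV[R]_p -> \bar R} :=
  if p is p'.+1 then lebesgue_step (lebesgue_cV p') else \d_(0 : 'cV[R]_0).

End lebesgue_vector.

Section random_vectors.
Context {d : measure_display} {Omega : measurableType d} {R : realType}.
Context (P : probability Omega R).

Definition independent_RVs d' (T : measurableType d') (N : nat)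
    (X : 'I_N -> {RV P >-> T}) : Prop :=
  forall (J : {set 'I_N}) (E : 'I_N -> set T),
    (forall t, measurable (E t)) ->
    P (\bigcap_(t in [set` J]) (X t @^-1` E t)) =
    (\prod_(t in J) P (X t @^-1` E t))%E.

Definition identically_distributed d' (T : measurableType d') (N : nat)
    (X : 'I_N -> {RV P >-> T}) : Prop :=
  forall (s t : 'I_N) (E : set T), measurable E ->
    distribution P (X s) E = distribution P (X t) E.

Definition has_density (p : nat) (X : {RV P >-> 'cV[R]_p}) : Prop :=
  exists f : 'cV[R]_p -> R,
    [/\ measurable_fun setT f,
        forall v, 0 <= f v
      & forall E, measurable E ->
          distribution P X E = (\int[lebesgue_cV p]_(v in E) (f v)%:E)%E].

End random_vectors.

Definition minkowski_sum (V : zmodType) (A B : set V) : set V :=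
  [set a + b | a in A & b in B].

(* Signals are functions on all of nat, but on a horizon N only their values at
   times t < N (t <= N for the state) are constrained or used. *)
Section DPV.
Context {R : realType} {n m p l : nat} {Par : {fset 'cV[R]_l}}.
Variables (A : Par -> 'M[R]_n) (B : Par -> 'M[R]_(n, m))
  (F : Par -> 'M[R]_(n, p)) (lam : nat -> Par).

(* A(lam_(j-1)) *m ... *m A(lam_i), and the identity when i = j *)
Definition transition (i j : nat) : 'M[R]_n :=
  \big[mulmx/1%:M]_(k <- rev (index_iota i j)) A (lam k).

(* Block k < tau of these matrices is the one involving time tau - 1 - k. The
   block library gives the dimension m * tau in the form \sum_(k < tau) m. *)
Definition ctrl_input (tau : nat) : 'M[R]_(n, \sum_(k < tau) m) :=
  \mxrow_(k < tau) (transition (tau - k) tau *m B (lam (tau - k.+1))).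

Definition ctrl_noise (tau : nat) : 'M[R]_(n, \sum_(k < tau) p) :=
  \mxrow_(k < tau) (transition (tau - k) tau *m F (lam (tau - k.+1))).

Definition stack (q : nat) (v : nat -> 'cV[R]_q) (tau : nat) :
    'cV[R]_(\sum_(k < tau) q) :=
  \mxcol_(k < tau) v (tau - k.+1)%N.

Definition x_nodist (x0 : 'cV[R]_n) (u : nat -> 'cV[R]_m) (tau : nat) :
    'cV[R]_n :=
  transition 0 tau *m x0 + ctrl_input tau *m stack u tau.

Section noise.
Context {d : measure_display} {Omega : measurableType d}.
Context {P : probability Omega R}.
Variable w : nat -> {RV P >-> 'cV[R]_p}.

Definition Wdist (tau : nat) (om : Omega) : 'cV[R]_n :=
  ctrl_noise tau *m stack (fun t => w t om) tau.

Lemma measurable_Wdist tau : measurable_fun setT (Wdist tau).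
Proof.
apply: measurable_fun_coordP => i j.
under eq_fun do rewrite mxE.
apply: measurable_sum => s; apply: measurable_funM => //.
under eq_fun do rewrite mxE.
exact: (measurableT_comp (measurable_coord _ _)).
Qed.

HB.instance Definition _ tau :=
  isMeasurableFun.Build _ _ _ _ (Wdist tau) (measurable_Wdist tau).

Definition is_dpv_state (N : nat) (x0 : 'cV[R]_n) (u : nat -> 'cV[R]_m)
    (x : nat -> {RV P >-> 'cV[R]_n}) : Prop :=
  (forall om, x 0 om = x0) /\
  (forall t, (t < N)%N -> forall om,
     x t.+1 om = A (lam t) *m x t om + B (lam t) *m u t + F (lam t) *m w t om).

End noise.
End DPV.

(* Main.v *)
Require Import Defs.
From HB Require Import structures.
From mathcomp Require Import all_boot all_order all_algebra finmap.
From mathcomp Require Import all_classical all_reals all_analysis.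
Set Implicit Arguments.
Unset Strict Implicit.
Unset Printing Implicit Defensive.
Import Order.TTheory GRing.Theory Num.Theory.
Import numFieldNormedType.Exports.
Local Open Scope classical_set_scope.
Local Open Scope ring_scope.

(** Fix an outcome [om]. The dynamics are then an affine recursion, and unrolling it
    ([affine_recursionE]) splits the state into the deterministic [x_nodist] plus the noise term
    [Wdist] ([dpv_stateE]). Hence the state lies in [G] exactly when [Wdist] lies in [G] translated
    by [- x_nodist] ([mem_minkowski_sum1N]). The two events are the same subset of [Omega], so their
    probabilities agree. *)

Section affine_recursion.
Context {R : realType} {n l : nat} {Par : {fset 'cV[R]_l}}.
Variables (A : Par -> 'M[R]_n) (lam : nat -> Par).

Lemma transition_id t : transition A lam t t = 1%:M.
Proof. by rewrite /transition /index_iota subnn big_nil. Qed.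

Lemma transition_recr i t : (i <= t)%N ->
  transition A lam i t.+1 = A (lam t) *m transition A lam i t.
Proof.
by move=> it; rewrite /transition /index_iota subSn// -addn1 iotaD rev_cat
  big_cons subnKC.
Qed.

(** Turns the block form shared by [ctrl_input] and [ctrl_noise] into the chronological sum that
    unrolling the recursion produces. *)
Lemma mxrow_transition_stack q (C : Par -> 'M[R]_(n, q)) (v : nat -> 'cV[R]_q)
    t :
  \mxrow_(k < t) (transition A lam (t - k) t *m C (lam (t - k.+1)%N)) *m
    stack v t =
  \sum_(k < t) transition A lam k.+1 t *m (C (lam k) *m v k).
Proof.
(* Block [k] carries time [t - k.+1], so the blocks run backwards in time. *)
rewrite mul_mxrow_mxcol [RHS](reindex_inj rev_ord_inj) /=.
by apply: eq_bigr => k _; rewrite -subSn// subSS mulmxA.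
Qed.

(** Discrete variation of constants: the input [b k] enters at time [k.+1] and is then transported
    to time [t]. *)
Lemma affine_recursionE (x b : nat -> 'cV[R]_n) N :
  (forall t, (t < N)%N -> x t.+1 = A (lam t) *m x t + b t) ->
  forall t, (t <= N)%N ->
  x t = transition A lam 0 t *m x 0%N +
        \sum_(k < t) transition A lam k.+1 t *m b k.
Proof.
move=> xS; elim=> [_|t IH tN].
  by rewrite transition_id mul1mx big_ord0 addr0.
(* The newest input [b t] has the identity as its transition; every older term gains a factor
   [A (lam t)] on the left. *)
rewrite xS// IH 1?ltnW// big_ord_recr/= transition_id mul1mx addrA.
rewrite transition_recr// mulmxDr mulmxA mulmx_sumr; congr (_ + _ + _).
by apply: eq_bigr => k _; rewrite transition_recr ?mulmxA.
Qed.

End affine_recursion.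

Lemma mem_minkowski_sum1N (V : zmodType) (G : set V) (c y : V) :
  minkowski_sum G [set - c] y <-> G (c + y).
Proof.
split=> [[a Ga [_ -> <-]]|Gcy]; first by rewrite addrC subrK.
by exists (c + y) => //; exists (- c) => //; rewrite addrC addKr.
Qed.

Lemma dpv_stateE (R : realType) (d : measure_display)
    (Omega : measurableType d) (P : probability Omega R) (N n m p l : nat)
    (Par : {fset 'cV[R]_l})
    (A : Par -> 'M[R]_n) (B : Par -> 'M[R]_(n, m)) (F : Par -> 'M[R]_(n, p))
    (lam : nat -> Par) (x0 : 'cV[R]_n) (u : nat -> 'cV[R]_m)
    (w : nat -> {RV P >-> 'cV[R]_p}) (x : nat -> {RV P >-> 'cV[R]_n}) :
  is_dpv_state A B F lam w N x0 u x ->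
  forall t om, (t <= N)%N ->
  x t om = x_nodist A B lam x0 u t + Wdist A F lam w t om.
Proof.
move=> [x_init xS] t om tN.
(* Control and noise together form one input; linearity separates them again below. *)
rewrite (@affine_recursionE _ _ _ _ A lam (fun t => x t om)
  (fun t => B (lam t) *m u t + F (lam t) *m w t om) N)//; last first.
  by move=> s sN; rewrite xS// addrA.
rewrite x_init /x_nodist /Wdist /ctrl_input /ctrl_noise.
rewrite !mxrow_transition_stack -addrA -big_split; congr (_ + _).
by apply: eq_bigr => k _; rewrite mulmxDr.
Qed.

Theorem theorem1 (R : realType) (d : measure_display)
    (Omega : measurableType d) (P : probability Omega R)
    (N n m p l : nat)
    (hN : (1 <= N)%N) (hn : (1 <= n)%N) (hm : (1 <= m)%N) (hp : (1 <= p)%N)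
    (hl : (1 <= l)%N)
    (Par : {fset 'cV[R]_l})
    (A : Par -> 'M[R]_n) (B : Par -> 'M[R]_(n, m)) (F : Par -> 'M[R]_(n, p))
    (lam : nat -> Par) (x0 : 'cV[R]_n) (u : nat -> 'cV[R]_m)
    (w : nat -> {RV P >-> 'cV[R]_p}) (x : nat -> {RV P >-> 'cV[R]_n})
    (w_indep : independent_RVs (fun t : 'I_N => w t))
    (w_ident : identically_distributed (fun t : 'I_N => w t))
    (w_density : forall t, (t < N)%N -> has_density (w t))
    (x_state : is_dpv_state A B F lam w N x0 u x)
    (tau : nat) (htau : (1 <= tau <= N)%N)
    (G : set 'cV[R]_n) (hG : measurable G) :
  distribution P (x tau) G =
  distribution P (Wdist A F lam w tau)
    (minkowski_sum G [set - x_nodist A B lam x0 u tau]).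
Proof.
have /andP[_ tauN] := htau.
(* Both laws are [P] of a preimage, so equality of the preimages suffices. *)
rewrite /distribution /pushforward; congr (P _); apply/seteqP; split=> om /=;
  by rewrite (dpv_stateE x_state)// => /mem_minkowski_sum1N.
Qed.
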